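(* Let $k, d$ be integers with $2 \leq k \leq 5$ and $1 \leq d \leq 10$, and let $\{t_n\}_{n\geq 0}$ be the $2k$-nacci sequence. Call a solution of the equation $$m! = \prod_{i=1}^d t_{n_i}$$ in positive integers $m, n_1, \ldots, n_d$ non-trivial if $t_{n_i} > 1$ for each $i$. Then the only non-trivial solution of this equation, over all such $k$ and $d$, is $t_5 = 3!$ in the $4$-nacci sequence (that is, $k = 2$, $d = 1$, $n_1 = 5$, $m = 3$).
   Context: The $2k$-nacci sequence $\{t_n\}_{n\geq 0}$ is defined by $t_0 = 0$, $t_n = 1$ for $1 \leq n \leq 2k-1$, and $t_n = \sum_{i=1}^{2k} t_{n-i}$ for $n \geq 2k$. *)

(* Defs.v *)
From mathcomp Require Import all_boot.

Set Implicit Arguments.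
Unset Strict Implicit.
Unset Printing Implicit Defensive.

(* The list [:: t_n; ...; t_0] of the first terms of the 2k-nacci sequence,
   most recent first; carrying the whole list makes the order-2k recurrence
   structural.  The defining equations are [nacci0], [nacci1], [nacci_rec]. *)
Fixpoint nacci_rev (k n : nat) : seq nat :=
  if n is n'.+1 then
    let s := nacci_rev k n' in
    (if n < 2 * k then 1 else sumn (take (2 * k) s)) :: s
  else [:: 0].

Definition nacci (k n : nat) : nat := head 0 (nacci_rev k n).

Lemma size_nacci_rev k n : size (nacci_rev k n) = n.+1.
Proof. by elim: n => //= n ->. Qed.

Lemma nth_nacci_rev k n i :
  i <= n -> nth 0 (nacci_rev k n) i = nacci k (n - i).
Proof.
elim: n i => [|n IHn] [|i] //= le_in.
by rewrite IHn // subSS.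
Qed.

Lemma nacci0 k : nacci k 0 = 0.
Proof. by []. Qed.

Lemma nacci1 k n : 1 <= n <= 2 * k - 1 -> nacci k n = 1.
Proof.
case: n => // n /andP[_ le_n]; rewrite /nacci /=.
suff -> : n.+1 < 2 * k by [].
by case: (2 * k) le_n => // j; rewrite subn1.
Qed.

Lemma nacci_rec k n : 0 < k -> 2 * k <= n ->
  nacci k n = \sum_(1 <= i < (2 * k).+1) nacci k (n - i).
Proof.
case: n => [|n] k_gt0 le_kn; first by case: k k_gt0 le_kn.
rewrite {1}/nacci /= ltnNge le_kn /= sumnE (big_nth 0).
rewrite size_takel ?size_nacci_rev // big_add1 /=.
apply: eq_big_nat => i /andP[_ lt_i].
by rewrite nth_take // nth_nacci_rev ?subSS // -ltnS (leq_trans lt_i).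
Qed.

Definition factorial_solution (k d m : nat) (n : 'I_d -> nat) : Prop :=
  [/\ 0 < m, forall i, 0 < n i & m`! = \prod_(i < d) nacci k (n i)].

Definition nontrivial_solution (k d m : nat) (n : 'I_d -> nat) : Prop :=
  factorial_solution k m n /\ forall i, 1 < nacci k (n i).

(* Main.v *)
Require Import Defs.
From Stdlib Require Import BinNat Nnat.
From mathcomp Require Import all_boot all_order all_algebra.
From mathcomp Require Import zify ring.

Set Implicit Arguments.
Unset Strict Implicit.
Unset Printing Implicit Defensive.

(** Write t for the 2k-nacci sequence, L = 2k+1 and v for the 2-adic valuation.

The recurrence of order 2k gives t(n+L) = 2 t(n+L-1) - t(n), so in the algebra
of shifts x^L = 2x^(L-1) - 1, whence x^(2L) = 1 + 4A with
A = x^(2L-2) - x^(L-1).  Consequently t is odd off the multiples of L, is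
2 modulo 4 at the odd multiples of L, and at the even multiples
t(2LN) = sum_i C(N,i) 4^i (A^i t)(0) ([newton_expansion]).  Since t(0) = 0 and
C(N,i) 4^i is divisible by 2^(v(N)+6) for i >= 3, the valuation of t(2LN) is
v(N) + e + 2, where 2^e is the exact power of 2 in (A t)(0), provided that
e <= 3 and 2^e divides (A^2 t)(0) ([newton_two_adic]).  This holds for
k = 2, ..., 5 and yields the uniform bound 2 * 2^v(t(n)) <= 3n
([expn2_logn_nacci]).

In a solution with at most ten factors some t(n) carries at least a tenth of
v(m!), which is at least 2^a - 1 when 2^a <= m < 2^(a+1).  As t grows
exponentially and t(n) <= m!, the index n is O(a 2^a), so v(t(n)) <= 2a - 2,
and 2^a - 1 <= 20a - 20 is false for a >= 7: thus m < 128 ([solution_lt128]).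
If 64 <= m < 128, some term divisible by 2^7 divides 127!; if 32 <= m < 64,
some term divisible by 2^4 divides 63!.  Only a bounded number of terms has to
be looked at, and none of them has the property ([solution_lt32]).  For m < 32
the few terms dividing m! are known, and an exhaustive enumeration of the
multisets of at most ten of them with product m! leaves 3! = t(5) for k = 2
([factorizations_complete], [only_3_factorialP]).  The finite computations are
carried out on binary integers. *)

(** * Recurrence, monotonicity and growth *)

(** Subtracting two consecutive instances of the order-2k recurrence. *)
Lemma nacci_shift k n : 0 < k ->
  nacci k (n + (2 * k).+1) + nacci k n = 2 * nacci k (n + 2 * k).
Proof.
move=> k0.
have h1 := @nacci_rec k (n + (2 * k).+1) k0 ltac:(lia).
have h2 := @nacci_rec k (n + 2 * k) k0 ltac:(lia).
rewrite big_nat_recr /= in h2; last by lia.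
rewrite big_nat_recl in h1; last by lia.
rewrite addnS subSS subn0 in h1; rewrite addnK in h2.
suff E : \sum_(1 <= i < 2 * k) nacci k ((n + 2 * k).+1 - i.+1) =
         \sum_(1 <= i < 2 * k) nacci k (n + 2 * k - i).
  by rewrite addnS h1 E; lia.
by apply: eq_bigr => i _; congr nacci; lia.
Qed.

Lemma leq_nacci_next k n : 0 < k -> nacci k n <= nacci k n.+1.
Proof.
move=> k0; case: (ltnP n.+1 (2 * k)) => hn.
  rewrite (@nacci1 k n.+1); last by lia.
  by case: n hn => [|n] hn; rewrite ?nacci0 // nacci1 //; lia.
rewrite (@nacci_rec k n.+1) // big_nat_recl; last by lia.
by rewrite subSS subn0 leq_addr.
Qed.

Lemma leq_nacci k : 0 < k -> {homo nacci k : i j / i <= j}.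
Proof.
move=> k0; apply: homo_leq => // [|i]; first exact: leq_trans.
exact: leq_nacci_next.
Qed.

Lemma nacci_double k n : 0 < k -> 2 * k <= n.+2 ->
  2 * nacci k n <= nacci k n.+2.
Proof.
move=> k0 hn; rewrite [nacci k n.+2]nacci_rec //.
rewrite big_nat_recl; last by lia.
rewrite (_ : 2 * k = (2 * k).-1.+1); last by lia.
rewrite big_nat_recl; last by lia.
rewrite !subSS !subn0 mul2n -addnn addnA.
by apply: leq_trans (leq_addr _ _); rewrite leq_add2r leq_nacci_next.
Qed.

(** Two steps of the sequence at least double it; this crude exponential growth is
all that the bound on the indices requires. *)
Lemma expn2_le_nacci k j : 0 < k -> 2 ^ j <= nacci k (2 * k + 2 * j).
Proof.
move=> k0; elim: j => [|j IH].
  rewrite muln0 addn0 expn0; apply: leq_trans (leq_nacci k0 (_ : 1 <= _)); last by lia.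
  by rewrite nacci1; lia.
rewrite (_ : 2 * k + 2 * j.+1 = (2 * k + 2 * j).+2); last by lia.
by rewrite expnS (leq_trans _ (nacci_double k0 _)) ?leq_mul2l ?IH ?orbT; lia.
Qed.

Lemma nacci_gt0 k n : 0 < k -> 0 < n -> 0 < nacci k n.
Proof.
move=> k0 n0; apply: leq_trans (leq_nacci k0 n0).
by rewrite nacci1; lia.
Qed.

Lemma index_bound k n B : 0 < k -> nacci k n <= 2 ^ B -> n <= 2 * B + 2 * k + 1.
Proof.
move=> k0 h; rewrite leqNgt; apply/negP => hn.
have h1 : 2 * k + 2 * B.+1 <= n by lia.
have := leq_trans (expn2_le_nacci B.+1 k0) (leq_nacci k0 h1).
by move/leq_trans => /(_ _ h); rewrite leq_exp2l //; lia.
Qed.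

(** * Two-adic valuation of the terms *)
Section TwoAdic.
Import GRing.Theory.
Local Open Scope ring_scope.

Definition trinomial_seq (k : nat) (a : nat -> int) : Prop :=
  forall n, a (n + (2 * k).+1)%N = 2 * a (n + 2 * k)%N - a n.

(** The operator x^(2L-2) - x^(L-1) in the shift x, with L = 2k+1.  On a
[trinomial_seq] it is a quarter of the difference operator of step 2L, see
[trinomial_step]. *)
Definition quarter_diff (k : nat) (a : nat -> int) (n : nat) : int :=
  a (n + 4 * k)%N - a (n + 2 * k)%N.

Lemma trinomial_quarter_diff k a : trinomial_seq k a -> trinomial_seq k (quarter_diff k a).
Proof.
move=> ha n; rewrite /quarter_diff !(addnAC n (2 * k).+1) !ha.
by rewrite (addnAC n (4 * k)%N); ring.
Qed.

(** Squaring x^L = 2x^(L-1) - 1 gives x^(2L) = 1 + 4 (x^(2L-2) - x^(L-1)). *)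
Lemma trinomial_step k a n : trinomial_seq k a ->
  a (n + 2 * (2 * k).+1)%N = a n + 4 * quarter_diff k a n.
Proof.
move=> ha; rewrite /quarter_diff.
have h0 := ha n.
have h1 := ha (n + 2 * k)%N.
have h2 := ha (n + (2 * k).+1)%N.
rewrite (_ : n + 2 * (2 * k).+1 = n + (2 * k).+1 + (2 * k).+1)%N; last by lia.
rewrite (_ : n + (2 * k).+1 + 2 * k = n + 2 * k + (2 * k).+1)%N in h2; last by lia.
rewrite (_ : n + 4 * k = n + 2 * k + 2 * k)%N; last by lia.
by lia.
Qed.

(** Newton's forward difference formula with step 2L, that is, the binomial
expansion of (1 + 4A)^N; the induction on N is Pascal's rule, and it needs the
formula for the sequence and for its quarter difference. *)
Lemma newton_expansion k N a n : trinomial_seq k a ->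
  a (n + N * (2 * (2 * k).+1))%N =
  \sum_(i < N.+1) 'C(N, i)%:R * 4 ^+ i * iter i (quarter_diff k) a n.
Proof.
elim: N a n => [|N IH] a n ha.
  by rewrite mul0n addn0 big_ord1 bin0 expr0 !mul1r.
rewrite mulSn [(_ + N * _)%N]addnC addnA (trinomial_step _ ha).
rewrite IH // (IH _ _ (trinomial_quarter_diff ha)).
rewrite [RHS]big_ord_recl /= bin0 expr0 !mul1r.
under [in RHS]eq_bigr => i _ do
  rewrite /bump /= add1n binS natrD mulrDl mulrDl.
rewrite big_split /= addrA; congr (_ + _).
  rewrite big_ord_recl /= bin0 expr0 !mul1r; congr (_ + _).
  by rewrite big_ord_recr /= bin_small // mulr0n !mul0r addr0.
rewrite mulr_sumr; apply: eq_bigr => i _.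
by rewrite -iterSr iterS exprS; ring.
Qed.

(** From i C(N,i) = N C(N-1,i-1), C(N,i) loses at most the valuation of i with
respect to N, and that valuation is at most 2i - 6 for i >= 3 (with equality
for i = 3 and i = 4). *)
Lemma dvdn_bin_pow4 N i : (0 < N)%N -> (2 < i)%N ->
  (2 ^ (logn 2 N + 6) %| 'C(N, i) * 4 ^ i)%N.
Proof.
move=> N0 i2; case: (leqP i N) => [iN|/bin_small ->]; last by rewrite mul0n.
have C0 : (0 < 'C(N, i))%N by rewrite bin_gt0.
have i0 : (0 < i)%N by lia.
rewrite pfactor_dvdn ?muln_gt0 ?C0 ?expn_gt0 //.
rewrite lognM ?expn_gt0 // lognX -[4%N]/(2 ^ 2)%N pfactorK //.
have hi : (logn 2 i + 6 <= 2 * i)%N.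
  have [i5|i5] := ltnP i 5; first by case: i i2 i5 {iN C0 i0} => [|[|[|[|[|i]]]]].
  have h : (i <= 2 ^ i.-1)%N.
    by rewrite -[X in (X <= _)%N](prednK i0) ltn_expl.
  have := leq_trans (dvdn_leq i0 (pfactor_dvdnn 2 i)) h.
  by rewrite leq_exp2l //; lia.
have hd : (logn 2 N <= logn 2 i + logn 2 'C(N, i))%N.
  rewrite -lognM // -[i in (i * _)%N](prednK i0) -[in 'C(_, _)](prednK i0).
  by rewrite -mul_bin_diag dvdn_leq_log ?dvdn_mulr // muln_gt0 N0 bin_gt0; lia.
lia.
Qed.

(** In the Newton expansion at 0 the term i = 1 has valuation exactly
v(N) + e + 2, the term i = 2 equals 8N(N-1) times a multiple of 2^e, and the
remaining ones are divisible by 2^(v(N)+6); as e <= 3, all terms but the one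
for i = 1 have a larger valuation. *)
Lemma newton_two_adic k a e (x y : int) N : trinomial_seq k a -> a 0 = 0 ->
  quarter_diff k a 0 = 2 ^+ e * (2 * x + 1) -> quarter_diff k (quarter_diff k a) 0 = 2 ^+ e * y ->
  (e <= 3)%N -> (0 < N)%N ->
  exists z : int, a (N * (2 * (2 * k).+1))%N = 2 ^+ (logn 2 N + e + 2) * (2 * z + 1).
Proof.
move=> ha a0 hx hy e3 N0.
(* [F i] is the i-th term of the expansion; padding the sum with two null terms
   lets the first three be split off for every N. *)
pose F i := 'C(N, i)%:R * 4 ^+ i * iter i (quarter_diff k) a 0.
have hF : a (N * (2 * (2 * k).+1))%N =
    F 0 + F 1 + F 2 + \sum_(i < N) F i.+3.
  have := newton_expansion N 0 ha; rewrite add0n => ->.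
  transitivity (\sum_(i < N.+3) F i).
    rewrite [in RHS]big_ord_recr [in RHS]big_ord_recr /= /F.
    by rewrite [in RHS]bin_small // [in RHS]bin_small // !mul0r !addr0.
  by rewrite 3!big_ord_recl /= !addrA; congr (_ + _); apply: eq_bigr.
have [Z hZ] : exists Z, \sum_(i < N) F i.+3 = Z * 2 ^+ (logn 2 N + 6).
  apply/dvdzP; apply: rpred_sum => i _; apply: dvdz_mulr.
  have := @dvdn_bin_pow4 N i.+3 N0 isT.
  rewrite -[in (_ %| _)%N](absz_nat (2 ^ _)) -(absz_nat ('C(_, _) * _)).
  by rewrite -dvdzE -!natz natrM !natrX.
have [u] := pfactor_coprime (isT : prime 2) N0.
rewrite coprime2n => ou hN.
have hu : (u = 2 * u./2 + 1)%N by have := odd_double_half u; rewrite ou; lia.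
set v := logn 2 N in hN hZ *.
have hC : 2 * ('C(N, 2)%:R : int) = N%:R * (N.-1)%:R.
  have := mul_bin_diag N 1; rewrite bin1 => h.
  by rewrite -!natrM h.
have hNr : (N%:R : int) = (2 * (u./2)%:R + 1) * 2 ^+ v.
  by rewrite [in LHS]hN [in LHS]hu natrM natrX natrD natrM.
exists (u./2%:R * (2 * x + 1) + x + (2 * (u./2)%:R + 1) * N.-1%:R * y + 2 ^+ (3 - e) * Z).
rewrite hF hZ /F /= a0 bin1 hx hy mulr0 add0r hNr.
have -> : 'C(N, 2)%:R * 4 ^+ 2 * (2 ^+ e * y) =
   (2 * 'C(N, 2)%:R) * 8 * (2 ^+ e * y) :> int by ring.
rewrite hC hNr.
have -> : (v + 6 = v + e + 3 + (3 - e))%N by lia.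
rewrite !exprD; ring.
Qed.

End TwoAdic.

Lemma logn_two_odd (t s : nat) (z : int) :
  (Posz t = 2 ^+ s * (2 * z + 1))%R -> logn 2 t = s.
Proof.
move=> h.
have -> : t = 2 ^ s * `|(2 * z + 1)%R|.
  by rewrite -[LHS]absz_nat h abszM abszX.
rewrite lognM ?expn_gt0 //; last by lia.
rewrite pfactorK // lognE dvdn2.
have -> : odd `|(2 * z + 1)%R| by lia.
by rewrite !andbF addn0.
Qed.

(** * Binary computation of the terms *)
Fixpoint nacciN_rev (k n : nat) : seq N :=
  if n is n'.+1 then
    let s := nacciN_rev k n' in
    (if n < 2 * k then 1%num else foldr N.add 0%num (take (2 * k) s)) :: s
  else [:: 0%num].

Lemma to_nat_nacciN_rev k n :
  map N.to_nat (nacciN_rev k n) = nacci_rev k n.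
Proof.
elim: n => // n IH; rewrite [nacciN_rev _ _.+1]/= [nacci_rev _ _.+1]/= -IH.
rewrite map_cons; congr (_ :: _); case: ifP => // _.
rewrite -map_take; elim: (take _ _) => //= x s IHs.
by rewrite N2Nat.inj_add IHs.
Qed.

Definition nacciN k n := head 0%num (nacciN_rev k n).

Lemma to_nat_nacciN k n : N.to_nat (nacciN k n) = nacci k n.
Proof.
by rewrite /nacciN /nacci -to_nat_nacciN_rev; case: (nacciN_rev k n).
Qed.

(** * Valuations for the 2k-nacci sequence *)
Lemma trinomial_nacci k : 0 < k -> trinomial_seq k (Posz \o nacci k).
Proof. by move=> k0 n /=; have := nacci_shift n k0; lia. Qed.

Lemma nacci_2k k : 0 < k -> nacci k (2 * k) = (2 * k).-1.
Proof.
move=> k0; rewrite nacci_rec // big_nat_recr /=; last by lia.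
rewrite subnn nacci0 addn0.
have -> : \sum_(1 <= i < 2 * k) nacci k (2 * k - i) = \sum_(1 <= i < 2 * k) 1.
  by apply: eq_big_nat => i hi; rewrite nacci1; lia.
by rewrite sum_nat_const_nat; lia.
Qed.

(** Modulo 2 the sequence has period L, and its first period is 0 followed by odd
numbers. *)
Lemma logn_nacci_not_dvd k n : 0 < k -> ~~ ((2 * k).+1 %| n) ->
  logn 2 (nacci k n) = 0.
Proof.
move=> k0 hn; rewrite lognE dvdn2.
suff -> : odd (nacci k n) by rewrite !andbF.
rewrite (divn_eq n (2 * k).+1) addnC.
have : n %% (2 * k).+1 < (2 * k).+1 by rewrite ltn_mod.
move: hn; rewrite /dvdn; move: (n %% _) (n %/ _) => r q r0 rL.
elim: q => [|q IH].
  rewrite mul0n addn0; have [->|rk] := eqVneq r (2 * k).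
    by rewrite nacci_2k; lia.
  by rewrite nacci1; lia.
have := nacci_shift (r + q * (2 * k).+1) k0.
by rewrite -addnA -mulSnr => h; lia.
Qed.

(** Modulo 4 the sequence has period 2L, and t(L) = 2(2k-1). *)
Lemma logn_nacci_odd_multiple k j : 0 < k ->
  logn 2 (nacci k ((2 * k).+1 + j * (2 * (2 * k).+1))) = 1.
Proof.
move=> k0.
suff [z hz] : exists z : int,
    (Posz (nacci k ((2 * k).+1 + j * (2 * (2 * k).+1))) = 2 ^+ 1 * (2 * z + 1))%R.
  exact: logn_two_odd hz.
elim: j => [|j [z hz]].
  exists (Posz k.-1); have := nacci_shift 0 k0.
  by rewrite nacci0 mul0n !add0n !addn0 nacci_2k // GRing.expr1; lia.
exists (z + quarter_diff k (Posz \o nacci k) ((2 * k).+1 + j * (2 * (2 * k).+1)))%R.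
have := trinomial_step ((2 * k).+1 + j * (2 * (2 * k).+1)) (trinomial_nacci k0).
by rewrite /= -addnA -mulSnr hz => ->; rewrite GRing.expr1; ring.
Qed.

Lemma quarter_diff_nacciN k e (p x y : N) : N.to_nat p = 2 ^ e ->
  nacciN k (4 * k) = (nacciN k (2 * k) + p * (2 * x + 1))%num ->
  (nacciN k (8 * k) + nacciN k (4 * k) = 2 * nacciN k (6 * k) + p * y)%num ->
  (quarter_diff k (Posz \o nacci k) 0 = 2 ^+ e * (2 * Posz (N.to_nat x) + 1))%R /\
  (quarter_diff k (quarter_diff k (Posz \o nacci k)) 0 = 2 ^+ e * Posz (N.to_nat y))%R.
Proof.
move=> hp h4 h8.
have -> : (2 ^+ e = Posz (N.to_nat p))%R by rewrite hp -natz GRing.natrX.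
have h6 : 2 * k + 4 * k = 6 * k by lia.
have h8' : 4 * k + 4 * k = 8 * k by lia.
have h4' : 2 * k + 2 * k = 4 * k by lia.
have h6' : 4 * k + 2 * k = 6 * k by lia.
rewrite /quarter_diff /= !add0n h8' h6 h4' h6' -!to_nat_nacciN.
by split; lia.
Qed.

(** The hypotheses of [newton_two_adic], with e = 1, 2, 1, 3 for k = 2, 3, 4, 5;
the values are (A t)(0) = 38, 284, 1658, 8696 and
(A^2 t)(0) = 6710, 1036240, 104834720, 9020304896.  The first inequality makes
the bound of [expn2_logn_nacci] uniform in k. *)
Lemma quarter_diff_nacci k : 2 <= k <= 5 -> exists e (x y : int),
  [/\ 2 ^ (e + 3) <= 6 * (2 * k).+1, e <= 3,
      (quarter_diff k (Posz \o nacci k) 0 = 2 ^+ e * (2 * x + 1))%R &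
      (quarter_diff k (quarter_diff k (Posz \o nacci k)) 0 = 2 ^+ e * y)%R].
Proof.
move=> hk; suff [e [p [x [y [h1 h2 h3 h4 h5]]]]] : exists e (p x y : N),
    [/\ 2 ^ (e + 3) <= 6 * (2 * k).+1, e <= 3, N.to_nat p = 2 ^ e,
     nacciN k (4 * k) = (nacciN k (2 * k) + p * (2 * x + 1))%num &
     (nacciN k (8 * k) + nacciN k (4 * k) = 2 * nacciN k (6 * k) + p * y)%num].
  have [h6 h7] := quarter_diff_nacciN h3 h4 h5.
  by exists e, (Posz (N.to_nat x)), (Posz (N.to_nat y)).
case: k hk => [|[|[|[|[|[|k]]]]]] // _.
- by exists 1, 2%num, 9%num, 3355%num; split; vm_compute.
- by exists 2, 4%num, 35%num, 259060%num; split; vm_compute.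
- by exists 1, 2%num, 414%num, 52417360%num; split; vm_compute.
- by exists 3, 8%num, 543%num, 1127538112%num; split; vm_compute.
Qed.

(** At n = 2LN the valuation is v(N) + e + 2, and 2^v(N) <= N, so that
2 * 2^v(t(n)) <= 2^(e+3) N <= 6LN = 3n. *)
Lemma expn2_logn_nacci k n : 2 <= k <= 5 -> 0 < n ->
  2 * 2 ^ logn 2 (nacci k n) <= 3 * n.
Proof.
move=> hk n0; have k0 : 0 < k by lia.
have [/dvdnP[q nE]|/(logn_nacci_not_dvd k0)->] := boolP ((2 * k).+1 %| n);
  last by lia.
have := odd_double_half q; case: (odd q) => hq.
  have -> : n = (2 * k).+1 + q./2 * (2 * (2 * k).+1) by rewrite nE; lia.
  by rewrite logn_nacci_odd_multiple //; lia.
have nE' : n = q./2 * (2 * (2 * k).+1) by rewrite nE; lia.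
have q0 : 0 < q./2 by rewrite lt0n; apply: contraTneq n0 => h; rewrite nE' h.
have [e [x [y [h1 h2 h3 h4]]]] := quarter_diff_nacci hk.
have [z] := newton_two_adic (trinomial_nacci k0) erefl h3 h4 h2 q0.
rewrite /= -nE' => /logn_two_odd ->.
have h5 := dvdn_leq q0 (pfactor_dvdnn 2 q./2).
have -> : 2 * 2 ^ (logn 2 q./2 + e + 2) = 2 ^ logn 2 q./2 * 2 ^ (e + 3).
  by rewrite -expnS -expnD; congr (2 ^ _); lia.
apply: leq_trans (leq_mul h5 h1) _; rewrite nE'; lia.
Qed.

(** * Bounding m *)
Lemma logn2_fact_double n : logn 2 (2 * n)`! = n + logn 2 n`!.
Proof.
elim: n => // n IH.
rewrite (_ : 2 * n.+1 = (2 * n).+2); last by lia.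
rewrite !factS !lognM ?muln_gt0 ?fact_gt0 // IH.
have -> : (2 * n).+2 = 2 * n.+1 by lia.
rewrite lognM // (pfactorK 1) //.
have -> : logn 2 (2 * n).+1 = 0 by rewrite lognE dvdn2 /=; have -> : odd (2 * n) = false by lia.
lia.
Qed.

Lemma logn2_fact_ge a m : 2 ^ a <= m -> 2 ^ a - 1 <= logn 2 m`!.
Proof.
move=> h; have : logn 2 (2 ^ a)`! <= logn 2 m`!.
  by apply: dvdn_leq_log; rewrite ?fact_gt0 //; rewrite (fact_split h) dvdn_mulr.
apply: leq_trans; elim: a {h} => // a IH.
rewrite expnS logn2_fact_double; have := expn_gt0 2 a; lia.
Qed.

Lemma fact_le_expn b m : m < 2 ^ b -> m`! <= 2 ^ (b * m).
Proof.
rewrite expnM; elim: m => // m IH hm.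
by rewrite factS expnS leq_mul ?IH ?(ltnW hm) // (ltnW (ltnW hm)).
Qed.

(** Pigeonhole: the valuation of m! is the sum of at most ten valuations. *)
Lemma exists_logn_ge k d m (n : 'I_d -> nat) : 0 < k -> 0 < d <= 10 ->
  factorial_solution k m n ->
  exists i, logn 2 m`! <= 10 * logn 2 (nacci k (n i)).
Proof.
move=> k0 /andP[d0 d10] [m0 n0 E].
have [_ hs] : 0 < m`! /\ logn 2 m`! = \sum_(i < d) logn 2 (nacci k (n i)).
  rewrite E; elim/big_rec2: _ => [|i s p _ [p0 <-]]; first by rewrite logn1.
  by rewrite muln_gt0 p0 nacci_gt0 // lognM ?nacci_gt0.
apply/existsP; apply: contraT; rewrite negb_exists => /forallP h.
have : \sum_(i < d) (10 * logn 2 (nacci k (n i))).+1 <= \sum_(i < d) logn 2 m`!.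
  by apply: leq_sum => i _; rewrite ltnNge h.
have -> : \sum_(i < d) (10 * logn 2 (nacci k (n i))).+1 = 10 * logn 2 m`! + d.
  under eq_bigr => i _ do rewrite -addn1.
  by rewrite big_split /= -big_distrr /= -hs sum_nat_const card_ord muln1.
rewrite sum_nat_const card_ord.
have := leq_mul d10 (leqnn (logn 2 m`!)); lia.
Qed.

(** With 2^a <= m < 2^(a+1), a term t(n) carrying a tenth of the valuation of m!
has n <= 2(a+1)m + 2k + 1, because t(n) <= m! <= 2^((a+1)m); as
m <= 2^(a+1) - 1 and 2k + 1 <= 11 <= 2(a+1), this is at most (a+1) 2^(a+2).  Then
2^v(t(n)) <= 6 (a+1) 2^a < 2^(2a-1), while 10 v(t(n)) >= 2^a - 1. *)
Lemma solution_lt128 k d m (n : 'I_d -> nat) : 2 <= k <= 5 -> 0 < d <= 10 ->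
  factorial_solution k m n -> m < 128.
Proof.
move=> hk hd hsol; have k0 : 0 < k by lia.
have [i hi] := exists_logn_ge k0 hd hsol.
have [m0 n0 E] := hsol.
rewrite ltnNge; apply/negP => m128.
have /andP[am ma] := trunc_log_bounds (isT : 1 < 2) m0.
have a7 : 7 <= trunc_log 2 m by apply: (trunc_log_max (p := 2) (j := 7)).
move: (trunc_log 2 m) => a in am ma a7.
have hV := leq_trans (logn2_fact_ge am) hi.
have tm : nacci k (n i) <= m`!.
  by rewrite dvdn_leq ?fact_gt0 // E (bigD1 i) //= dvdn_mulr.
have hB := index_bound k0 (leq_trans tm (fact_le_expn ma)).
have h2 := expn2_logn_nacci hk (n0 i).
have hn : n i <= a.+1 * 2 ^ a * 4.
  have : a.+1 * m <= a.+1 * (2 ^ a.+1 - 1) by rewrite leq_mul2l; lia.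
  by rewrite expnS mulnBr; lia.
have ha : 6 * a.+1 < 2 ^ a.-1.
  elim: a a7 {am ma hV hB hn} => // a IH; rewrite ltnS leq_eqVlt.
  case/predU1P => [<-|/IH{IH}h] //.
  by case: a h => // a /= h; rewrite expnS; lia.
have hv : logn 2 (nacci k (n i)) < 2 * a - 1.
  rewrite -(ltn_exp2l _ _ (isT : 1 < 2)).
  have -> : 2 * a - 1 = a.-1 + a by lia.
  rewrite expnD; apply: (@leq_ltn_trans (6 * a.+1 * 2 ^ a)); first by lia.
  by rewrite ltn_pmul2r ?expn_gt0.
have hfin : 20 * a - 20 < 2 ^ a - 1.
  elim: a a7 {am ma hV hB hn ha hv} => // a IH; rewrite ltnS leq_eqVlt.
  case/predU1P => [<-|/[dup] a7 /IH{IH}h] //.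
  by rewrite expnS; lia.
lia.
Qed.

(** * The finite range of m *)
Fixpoint factN (m : nat) : N :=
  if m is m'.+1 then N.mul (N.of_nat m) (factN m') else 1%num.

Lemma to_nat_factN m : N.to_nat (factN m) = m`!.
Proof.
elim: m => // m IH.
by rewrite -[factN _]/(N.mul (N.of_nat m.+1) (factN m)) N2Nat.inj_mul IH Nat2N.id.
Qed.

Definition dvdN (t f : N) : bool := N.eqb (N.modulo f t) 0.

Lemma dvdn_dvdN t f : N.to_nat t %| N.to_nat f -> dvdN t f.
Proof.
case/dvdnP => q h; have -> : f = N.mul (N.of_nat q) t.
  by apply: N2Nat.inj; rewrite N2Nat.inj_mul Nat2N.id.
by rewrite /dvdN N.Div0.mod_mul.
Qed.

(** No term divisible by 2^v divides M!.  The terms up to index b suffice, since the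
b-th term already exceeds M!.  Nested conditionals keep the evaluation from
dividing M! by every term. *)
Definition no_dyadic_divisor (k v M b : nat) : bool :=
  let f := factN M in
  if N.ltb f (nacciN k b) then
    all (fun t => if dvdN (N.pow 2 (N.of_nat v)) t then ~~ dvdN t f else true)
      (nacciN_rev k b)
  else false.

Lemma to_nat_expn2 v : N.to_nat (N.pow 2 (N.of_nat v)) = 2 ^ v.
Proof.
elim: v => // v IH; rewrite Nat2N.inj_succ N.pow_succ_r ?N2Nat.inj_mul ?IH ?expnS //.
exact: N.le_0_l.
Qed.

Lemma ltb_to_nat x y : N.ltb x y -> N.to_nat x < N.to_nat y.
Proof. by move=> /N.ltb_spec0; lia. Qed.

Lemma index_lt k b m M n : 0 < k -> m <= M -> N.ltb (factN M) (nacciN k b) ->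
  nacci k n %| m`! -> n < b.
Proof.
move=> k0 mM /ltb_to_nat; rewrite to_nat_factN to_nat_nacciN => hb hd.
rewrite ltnNge; apply/negP => /(leq_nacci k0) bn.
have := dvdn_leq (fact_gt0 m) hd.
have := dvdn_leq (fact_gt0 M) (dvdn_trans hd _).
rewrite (fact_split mM) dvdn_mulr // -fact_split // => /(_ isT); lia.
Qed.

Lemma logn_lt_of_no_term k v M b m n : 0 < k -> no_dyadic_divisor k v M b -> m <= M ->
  0 < n -> nacci k n %| m`! -> logn 2 (nacci k n) < v.
Proof.
move=> k0; rewrite /no_dyadic_divisor; case: ifP => // hb /allP hall mM n0 hd.
have nb := index_lt k0 mM hb hd.
have hin : nacciN k n \in nacciN_rev k b.
  have /(nthP 0)[j] : nacci k n \in nacci_rev k b.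
    rewrite -(subKn (ltnW nb)) -nth_nacci_rev ?leq_subr // mem_nth //.
    by rewrite size_nacci_rev ltnS leq_subr.
  rewrite -to_nat_nacciN_rev size_map => hj; rewrite (nth_map 0%num) // => hE.
  rewrite -(N2Nat.id (nacciN k n)) to_nat_nacciN -hE N2Nat.id.
  exact: mem_nth.
have dvd_fact : dvdN (nacciN k n) (factN M).
  apply: dvdn_dvdN; rewrite to_nat_nacciN to_nat_factN (fact_split mM).
  exact: dvdn_mulr.
rewrite ltnNge; apply/negP => hv.
have dvd_pow : dvdN (N.pow 2 (N.of_nat v)) (nacciN k n).
  apply: dvdn_dvdN.
  by rewrite to_nat_expn2 to_nat_nacciN pfactor_dvdn // nacci_gt0.
by have := hall _ hin; rewrite dvd_pow dvd_fact.
Qed.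

(** The ways of writing f as a product of at most d values from the table c of
pairs (index, value), each returned as the list of the indices used, in the
order of the table. *)
Fixpoint factorizations (c : seq (nat * N)) : nat -> N -> seq (seq nat) :=
  if c is (n, t) :: c' then
    fix with_term d f :=
      factorizations c' d f ++
      if d is d'.+1 then
        if dvdN t f then map (cons n) (with_term d' (N.div f t)) else [::]
      else [::]
  else fun d f => if N.eqb f 1 then [:: [::]] else [::].

(** Either the first index of the table occurs in the multiset s and can be removed
from it, or s is covered by the rest of the table; removal only preserves s up
to permutation, hence [perm_eq]. *)
Lemma factorizations_complete (g : nat -> nat) (c : seq (nat * N)) d s :
  (forall n, n \in s -> 0 < g n) ->
  {in c, forall p, p.2 = N.of_nat (g p.1)} ->
  {subset s <= map fst c} -> size s <= d ->
  exists2 r, r \in factorizations c d (N.of_nat (\prod_(n <- s) g n)) &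
             perm_eq r s.
Proof.
elim: c d s => [|[n t] c IHc] d s g0 hc hs hd.
  have -> : s = [::] by case: s hs {g0 hd} => // x s /(_ x (mem_head _ _)).
  by exists [::] => //; rewrite big_nil.
have tE : t = N.of_nat (g n) by apply: (hc (n, t)); apply: mem_head.
subst t.
have skip d' s' : (forall j, j \in s' -> 0 < g j) -> n \notin s' ->
    {subset s' <= n :: map fst c} -> size s' <= d' ->
    exists2 r, r \in factorizations c d' (N.of_nat (\prod_(j <- s') g j)) &
               perm_eq r s'.
  move=> g0' ns hs' hd'; apply: IHc => // [p hp|j js].
    by apply: hc; rewrite inE hp orbT.
  by have := hs' j js; rewrite inE; case/predU1P => // jn; rewrite -jn js in ns.
elim: d s g0 hs hd => [|d IHd] s g0 hs hd; have [ns|ns] := boolP (n \in s).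
- by case: s hd ns {g0 hs}.
- have [r hr1 hr2] := skip 0 s g0 ns hs hd.
  by exists r => //; rewrite /= mem_cat hr1.
- have ps := perm_to_rem ns.
  have [|||r hr1 hr2] := IHd (rem n s).
  + by move=> x /mem_rem /g0.
  + by move=> x /mem_rem /hs.
  + by rewrite size_rem //; lia.
  exists (n :: r); last first.
    by rewrite perm_sym; apply: perm_trans ps _; rewrite perm_cons perm_sym.
  rewrite (perm_big _ ps) big_cons /=.
  rewrite mem_cat dvdn_dvdN ?Nat2N.id ?dvdn_mulr //.
  have -> : N.div (N.of_nat (g n * \prod_(j <- rem n s) g j)) (N.of_nat (g n)) =
      N.of_nat (\prod_(j <- rem n s) g j).
    rewrite Nat2N.inj_mul N.mul_comm N.div_mul //.
    by have := g0 n ns; case: (g n).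
  by apply/orP; right; apply: map_f.
- have [r hr1 hr2] := skip d.+1 s g0 ns hs hd.
  by exists r => //; rewrite /= mem_cat hr1.
Qed.

Definition nacci_table (k b : nat) : seq (nat * N) :=
  [seq (n, nacciN k n) | n <- iota 0 b].

Definition candidates (tab : seq (nat * N)) (f : N) : seq (nat * N) :=
  [seq p <- tab | N.ltb 1 p.2 & dvdN p.2 f].

(** For m <= M, the only way of writing m! as a product of at most ten terms
exceeding 1, apart from the empty product, is 3! = t(5) with k = 2; the first
condition ensures that the table contains every term dividing m!. *)
Definition only_3_factorial (k b M : nat) : bool :=
  let tab := nacci_table k b in
  N.ltb (factN M) (nacciN k b) &&
  all (fun m => let f := factN m in
    all (fun r => (r == [::]) || [&& k == 2, m == 3 & r == [:: 5]])
      (factorizations (candidates tab f) 10 f)) (iota 0 M.+1).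

(** The indices 780, 330 and 130 in these three checks are round values at which the
terms exceed 127!, 63! and 31! respectively, for each k. *)
Lemma no_dyadic_divisor_127 : all (fun k => no_dyadic_divisor k 7 127 780) (iota 2 4).
Proof. by vm_compute. Qed.
Lemma no_dyadic_divisor_63 : all (fun k => no_dyadic_divisor k 4 63 330) (iota 2 4).
Proof. by vm_compute. Qed.
Lemma only_3_factorial_upto31 : all (fun k => only_3_factorial k 130 31) (iota 2 4).
Proof. by vm_compute. Qed.

Lemma only_3_factorialP k b M m s : 0 < k -> only_3_factorial k b M -> m <= M ->
  {in s, forall j, 1 < nacci k j} -> size s <= 10 ->
  m`! = \prod_(j <- s) nacci k j ->
  s = [::] \/ [/\ k = 2, m = 3 & s = [:: 5]].
Proof.
move=> k0 /andP[hb /allP/(_ m)] + mM s1 s10 E.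
rewrite mem_iota ltnS mM => /(_ isT)/allP hall.
have hf : factN m = N.of_nat (\prod_(j <- s) nacci k j).
  by rewrite -E -to_nat_factN N2Nat.id.
have [||||r] := @factorizations_complete (nacci k)
    (candidates (nacci_table k b) (factN m)) 10 s.
- by move=> j /s1/ltnW.
- move=> p; rewrite mem_filter => /andP[_ /mapP[j _ ->]] /=.
  by rewrite -to_nat_nacciN N2Nat.id.
- move=> j js; apply/mapP; exists (j, nacciN k j) => //.
  have hdvd : nacci k j %| m`! by rewrite E (big_rem j) //= dvdn_mulr.
  rewrite mem_filter /= dvdn_dvdN ?to_nat_nacciN ?to_nat_factN //.
  have -> : N.ltb 1 (nacciN k j).
    by apply/N.ltb_spec0; have := s1 j js; rewrite -to_nat_nacciN; lia.
  rewrite map_f // mem_iota /=.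
  exact: index_lt k0 mM hb hdvd.
- exact: s10.
rewrite -hf => /hall/orP[/eqP->|/and3P[/eqP k2 /eqP m3 /eqP->]] hp.
  by left; apply/nilP; rewrite /nilp -(perm_size hp).
by right; split=> //; apply: perm_small_eq => //; rewrite perm_sym.
Qed.

(** For 64 <= m the valuation of m! is at least 63, so some term is divisible by
2^7; for 32 <= m it is at least 31, so some term is divisible by 2^4. *)
Lemma solution_lt32 k d m (n : 'I_d -> nat) : 2 <= k <= 5 -> 0 < d <= 10 ->
  factorial_solution k m n -> m < 32.
Proof.
move=> hk hd hsol; have k0 : 0 < k by lia.
have kin : k \in iota 2 4 by rewrite mem_iota.
have m128 := solution_lt128 hk hd hsol.
have [i hi] := exists_logn_ge k0 hd hsol.
have [_ n0 E] := hsol.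
have hdvd : nacci k (n i) %| m`! by rewrite E (bigD1 i) //= dvdn_mulr.
have [m64|m64] := ltnP m 64; last first.
  have := logn_lt_of_no_term k0 (allP no_dyadic_divisor_127 k kin) m128 (n0 i) hdvd.
  by have := logn2_fact_ge (m64 : 2 ^ 6 <= m); lia.
rewrite ltnNge; apply/negP => m32.
have := logn_lt_of_no_term k0 (allP no_dyadic_divisor_63 k kin) m64 (n0 i) hdvd.
by have := logn2_fact_ge (m32 : 2 ^ 5 <= m); lia.
Qed.

(** * The theorem *)
Theorem mainTheorem4 (k d m : nat) (n : 'I_d -> nat) :
  2 <= k <= 5 -> 1 <= d <= 10 ->
  nontrivial_solution k m n <->
  [/\ k = 2, d = 1, m = 3 & forall i : 'I_d, n i = 5].
Proof.
move=> hk hd; split; last first.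
  case=> -> d1 -> hn; subst d; split; last by move=> i; rewrite hn.
  by split=> // [i|]; rewrite ?big_ord1 hn.
case=> hsol ht; have [_ n0 E] := hsol; have k0 : 0 < k by lia.
have m32 := solution_lt32 hk hd hsol.
have kin : k \in iota 2 4 by rewrite mem_iota.
pose s := [seq n i | i <- enum 'I_d].
have sd : size s = d by rewrite size_map size_enum_ord.
have Es : m`! = \prod_(j <- s) nacci k j by rewrite E big_map big_enum.
have s1 : {in s, forall j, 1 < nacci k j} by move=> _ /mapP[i _ ->].
have s10 : size s <= 10 by rewrite sd; case/andP: hd.
have [s0|[k2 m3 s5]] := only_3_factorialP k0 (allP only_3_factorial_upto31 k kin) m32 s1 s10 Es.
  by exfalso; move: sd; rewrite s0 /=; lia.
split=> // [|i]; first by rewrite -sd s5.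
have : n i \in s by rewrite map_f ?mem_enum.
by rewrite s5 inE => /eqP.
Qed.
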